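(* Let $F>0$, let $N\ge2$ be an integer, $\varepsilon=1/N$, and let $y_F$ be the straight chain with nearest neighbor interatomic spacing $F\varepsilon$. Given $f\in\mathcal U$, let $u^{\mathrm a},u^{\mathrm{CB}}\in\mathcal U$ satisfy $$\delta\mathcal E^{\mathrm a}(y_F)[v]+\delta^2\mathcal E^{\mathrm a}(y_F)[u^{\mathrm a},v]=\langle f,v\rangle\quad\text{and}\quad\delta\mathcal E^{\mathrm{CB}}(y_F)[v]+\delta^2\mathcal E^{\mathrm{CB}}(y_F)[u^{\mathrm{CB}},v]=\langle f,v\rangle$$ for all $v\in\mathcal U$. If $$\gamma_2:=\min\left\{\phi''(F)+4\,\phi''(2F),\ \frac{\phi'(F)+2\,\phi'(2F)}{F}\right\}>0,$$ then $$\|(u^{\mathrm a}-u^{\mathrm{CB}})'\|_{\ell^2_\varepsilon}\le\frac{\varepsilon^2\max\left\{|\phi''(2F)|,\left|\frac{\phi'(2F)}{2F}\right|\right\}}{\gamma_2}\|(u^{\mathrm a})'''\|_{\ell^2_\varepsilon}.$$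
   Context: Let $\varepsilon=1/N$. $\mathcal Y$ is the set of sequences $y=\{y_\ell\}_{\ell\in\mathbb Z}$, $y_\ell\in\mathbb R^2$, with $y_{\ell+N}=y_\ell+(y_N-y_0)$ for all $\ell$. $\mathcal U$ is the set of $N$-periodic sequences $u$ in $\mathbb R^2$ with $\sum_{\ell=1}^N u_\ell=0$. Backward differences: $y'_\ell=(y_\ell-y_{\ell-1})/\varepsilon$, $y^{(n)}_\ell=(y^{(n-1)}_\ell-y^{(n-1)}_{\ell-1})/\varepsilon$. $\|\cdot\|$ is the Euclidean norm; $\langle v,w\rangle=\varepsilon\sum_{\ell=1}^N v_\ell\cdot w_\ell$, $\|v\|_{\ell^2_\varepsilon}=\langle v,v\rangle^{1/2}$. The pair potential $\phi:(0,\infty)\to\mathbb R$ is twice continuously differentiable. $\mathcal E^{\mathrm a}(y)=\varepsilon\sum_{\ell=1}^N[\phi(\|y'_\ell\|)+\phi(\|y'_{\ell+1}+y'_\ell\|)]$; $\mathcal E^{\mathrm{CB}}(y)=\varepsilon\sum_{\ell=1}^N[\phi(\|y'_\ell\|)+\phi(2\|y'_\ell\|)]$. First and second variations: $\delta\mathcal E(y)[u]=\frac{d}{dt}\mathcal E(y+tu)|_{t=0}$, $\delta^2\mathcal E(y)[u,v]=\frac{\partial^2}{\partial s\partial t}\mathcal E(y+su+tv)|_{s=t=0}$. The straight chain is $(y_F)_\ell=(F\varepsilon\ell,0)$ (up to translation along the line). *)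

(* Defs.v *)
From Stdlib Require Import Reals ZArith.
From Coquelicot Require Import Coquelicot.
Open Scope R_scope.

Definition R2 : NormedModule R_AbsRing :=
  prod_NormedModule R_AbsRing R_NormedModule R_NormedModule.

Definition dot (v w : R2) : R := fst v * fst w + snd v * snd w.

(** Coquelicot's norm on a product is the Euclidean one, not the sup norm. *)
Lemma norm_R2 (v : R2) : norm v = sqrt (dot v v).
Proof.
change (sqrt (Rabs (fst v) ^ 2 + Rabs (snd v) ^ 2) = sqrt (dot v v)).
rewrite !pow2_abs; unfold dot; f_equal; ring.
Qed.

Definition lattice_seq : Type := Z -> R2.

Definition eps (N : nat) : R := / INR N.

Definition bdiff (N : nat) (y : lattice_seq) : lattice_seq :=
  fun l => scal (/ eps N) (minus (y l) (y (l - 1)%Z)).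

Definition bdiff_n (n N : nat) (y : lattice_seq) : lattice_seq :=
  Nat.iter n (bdiff N) y.

Definition period_sum {G : AbelianMonoid} (N : nat) (a : Z -> G) : G :=
  sum_n_m (fun k => a (Z.of_nat k)) 1 N.

Definition displacement (N : nat) (u : lattice_seq) : Prop :=
  (forall l : Z, u (l + Z.of_nat N)%Z = u l) /\ period_sum N u = zero.

Definition inner (N : nat) (v w : lattice_seq) : R :=
  eps N * period_sum N (fun l => dot (v l) (w l)).

Definition l2norm (N : nat) (v : lattice_seq) : R := sqrt (inner N v v).

(** The potential is a total function; only its restriction to (0, oo) is
    constrained, and only its values and derivatives there are used. *)
Definition C2_on_pos (phi : R -> R) : Prop :=
  forall r : R, 0 < r ->
    ex_derive phi r /\ ex_derive (Derive phi) r /\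
    continuous (Derive_n phi 2) r.

Definition energy_a (phi : R -> R) (N : nat) (y : lattice_seq) : R :=
  let y' := bdiff N y in
  eps N * period_sum N (fun l =>
    phi (norm (y' l)) + phi (norm (plus (y' (l + 1)%Z) (y' l)))).

Definition energy_CB (phi : R -> R) (N : nat) (y : lattice_seq) : R :=
  let y' := bdiff N y in
  eps N * period_sum N (fun l =>
    phi (norm (y' l)) + phi (2 * norm (y' l))).

Definition seq_plus (y z : lattice_seq) : lattice_seq :=
  fun l => plus (y l) (z l).

Definition seq_minus (y z : lattice_seq) : lattice_seq :=
  fun l => minus (y l) (z l).

Definition seq_scal (t : R) (y : lattice_seq) : lattice_seq :=
  fun l => scal t (y l).

Definition variation1 (E : lattice_seq -> R) (y u : lattice_seq) : R :=
  Derive (fun t => E (seq_plus y (seq_scal t u))) 0.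

Definition variation2 (E : lattice_seq -> R) (y u v : lattice_seq) : R :=
  Derive (fun s =>
    Derive (fun t =>
      E (seq_plus (seq_plus y (seq_scal s u)) (seq_scal t v))) 0) 0.

(** The straight chain is determined up to the translation [c] along the
    line. *)
Definition straight_chain (N : nat) (F c : R) : lattice_seq :=
  fun l => (c + F * eps N * IZR l, 0).

Definition linearized_solution (E : lattice_seq -> R) (N : nat)
    (y f u : lattice_seq) : Prop :=
  forall v : lattice_seq, displacement N v ->
    variation1 E y v + variation2 E y u v = inner N f v.

Definition gamma2 (phi : R -> R) (F : R) : R :=
  Rmin (Derive_n phi 2 F + 4 * Derive_n phi 2 (2 * F))
       ((Derive phi F + 2 * Derive phi (2 * F)) / F).

(* Main.v *)
Require Import Defs.
From Stdlib Require Import Reals ZArith.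
From Stdlib Require Import Lra Lia.
From Coquelicot Require Import Coquelicot.
Open Scope R_scope.

(** Both second variations at the straight chain are diagonal in the two
    components of [u'], with the same nearest neighbour part.  With [q = ua'],
    [d = (ua - uCB)'] and [T k = (q k + q (k - 1)) * d k],
    [4 q(k) d(k) - (q(k+1) + q(k)) (d(k+1) + d(k))
      = - (q(k+1) - 2 q(k) + q(k-1)) d(k) - (T(k+1) - T(k))],
    so after summation over a period the two Hessians differ by
    [- eps^2 ua'''(k+1) . d(k)], weighted by [phi''(2F)] and [phi'(2F)/(2F)].
    Testing the difference of the two equations with [ua - uCB], using the
    coercivity constant [gamma2] of the Cauchy-Born Hessian and Young's
    inequality gives the estimate. *)

(** * Sums over one period *)

Section PeriodSum.

Variable N : nat.

Lemma period_sum_ext (a b : Z -> R) :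
  (forall k, a k = b k) -> period_sum N a = period_sum N b.
Proof. intros H; apply sum_n_m_ext; intros k; apply H. Qed.

Lemma period_sum_plus {G : AbelianMonoid} (a b : Z -> G) :
  period_sum N (fun k => plus (a k) (b k)) =
  plus (period_sum N a) (period_sum N b).
Proof. apply sum_n_m_plus. Qed.

Lemma period_sum_Rplus (a b : Z -> R) :
  period_sum N (fun k => a k + b k) = period_sum N a + period_sum N b.
Proof. apply (period_sum_plus (G := R_AbelianMonoid)). Qed.

Lemma period_sum_Rmult (c : R) (a : Z -> R) :
  period_sum N (fun k => c * a k) = c * period_sum N a.
Proof. apply (sum_n_m_scal_l (K := R_Ring) (V := R_ModuleSpace)). Qed.

Lemma period_sum_le (a b : Z -> R) :
  (forall k, a k <= b k) -> period_sum N a <= period_sum N b.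
Proof. intros H; apply sum_n_m_le; intros k; apply H. Qed.

(** The sum collapses to [T (N + 1) - T 1], which periodicity makes zero. This is the summation by
    parts of the final estimate. *)
Lemma period_sum_telescope (T : Z -> R) :
  (forall k, T (k + Z.of_nat N)%Z = T k) ->
  period_sum N (fun k => T (k + 1)%Z - T k) = 0.
Proof.
intros HT.
assert (H : forall n, sum_n_m (fun k =>
   T (Z.of_nat k + 1)%Z - T (Z.of_nat k)) 1 n = T (Z.of_nat n + 1)%Z - T 1%Z).
{ induction n as [|n IH].
  - rewrite sum_n_m_zero by lia. change (0 = T 1%Z - T 1%Z); ring.
  - rewrite sum_n_Sm by lia. rewrite IH.
    replace (Z.of_nat (S n)) with (Z.of_nat n + 1)%Z by lia.
    change (T (Z.of_nat n + 1)%Z - T 1%Z +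
      (T (Z.of_nat n + 1 + 1)%Z - T (Z.of_nat n + 1)%Z) =
      T (Z.of_nat n + 1 + 1)%Z - T 1%Z); ring. }
unfold period_sum; rewrite H.
rewrite Z.add_comm, HT; apply Rminus_diag.
Qed.

End PeriodSum.

(** * First and mixed second derivatives of two-parameter families *)

(** [a] and [b] are the values at the origin of [dH/dt] and [d^2H/dsdt]. *)
Definition has_variations (H : R -> R -> R) (a b : R) : Prop :=
  exists g : R -> R, g 0 = a /\
    locally 0 (fun s => is_derive (H s) 0 (g s)) /\ is_derive g 0 b.

Lemma has_variations_Derive H a b :
  has_variations H a b -> Derive (H 0) 0 = a.
Proof.
intros (g & <- & Hl & _).
apply is_derive_unique, (locally_singleton _ _ Hl).
Qed.

(** The inner derivative is known to equal [g s] only for [s] near 0, which is enough to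
    differentiate it at 0. *)
Lemma has_variations_Derive2 H a b :
  has_variations H a b -> Derive (fun s => Derive (H s) 0) 0 = b.
Proof.
intros (g & _ & Hl & Hg).
rewrite <- (is_derive_unique _ _ _ Hg).
apply Derive_ext_loc; revert Hl; apply filter_imp.
intros s; apply is_derive_unique.
Qed.

Lemma has_variations_plus H1 a1 b1 H2 a2 b2 :
  has_variations H1 a1 b1 -> has_variations H2 a2 b2 ->
  has_variations (fun s t => H1 s t + H2 s t) (a1 + a2) (b1 + b2).
Proof.
intros (g1 & <- & L1 & D1) (g2 & <- & L2 & D2).
exists (fun s => g1 s + g2 s); split; [reflexivity|split].
- generalize (filter_and _ _ L1 L2); apply filter_imp.
  intros s [A B]; exact (is_derive_plus _ _ _ _ _ A B).
- exact (is_derive_plus _ _ _ _ _ D1 D2).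
Qed.

Lemma has_variations_scal c H a b :
  has_variations H a b ->
  has_variations (fun s t => c * H s t) (c * a) (c * b).
Proof.
intros (g & <- & L & D).
exists (fun s => c * g s); split; [reflexivity|split].
- revert L; apply filter_imp.
  intros s A; exact (is_derive_scal _ _ c _ A).
- exact (is_derive_scal _ _ c _ D).
Qed.

Lemma has_variations_ext H H' a b :
  (forall s t, H s t = H' s t) ->
  has_variations H a b -> has_variations H' a b.
Proof.
intros E (g & A & L & D); exists g; split; [exact A|split; [|exact D]].
revert L; apply filter_imp; intros s; apply is_derive_ext; apply E.
Qed.

Lemma has_variations_const c : has_variations (fun _ _ => c) 0 0.
Proof.
exists (fun _ => 0); split; [reflexivity|split].
- apply filter_forall; intros s; exact (is_derive_const (V := R_NormedModule) c 0).
- exact (is_derive_const (V := R_NormedModule) 0 0).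
Qed.

Lemma has_variations_period_sum N (H : Z -> R -> R -> R) (a b : Z -> R) :
  (forall k, has_variations (H k) (a k) (b k)) ->
  has_variations (fun s t => period_sum N (fun k => H k s t))
    (period_sum N a) (period_sum N b).
Proof.
intros HH; unfold period_sum; induction N as [|n IH].
- rewrite !sum_n_m_zero by lia.
  apply has_variations_ext with (2 := has_variations_const 0).
  intros s t; rewrite sum_n_m_zero by lia; reflexivity.
- rewrite !sum_n_Sm by lia.
  apply has_variations_ext with (2 := has_variations_plus _ _ _ _ _ _ IH (HH _)).
  intros s t; rewrite sum_n_Sm by lia; reflexivity.
Qed.

(** A bond of length [r] along the first axis is perturbed by [s w + t z]. With [n s] its length at
    [t = 0], the [t]-derivative is [phi'(n s)] times the component of [z] along the bond. In its
    [s]-derivative at 0, the change of length gives the longitudinal stiffness [phi''(r)], and the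
    rotation of the bond gives the transverse stiffness [phi'(r) / r]. *)
Lemma has_variations_bond phi r w1 w2 z1 z2 :
  C2_on_pos phi -> 0 < r ->
  has_variations
    (fun s t => phi (sqrt ((r + s * w1 + t * z1) ^ 2 + (s * w2 + t * z2) ^ 2)))
    (Derive phi r * z1)
    (Derive_n phi 2 r * (w1 * z1) + Derive phi r / r * (w2 * z2)).
Proof.
intros hphi hr.
set (n := fun s => sqrt ((r + s * w1) ^ 2 + (s * w2) ^ 2)).
assert (n0 : n 0 = r).
{ unfold n; replace (_ + _) with (r ^ 2) by ring; apply sqrt_pow2; lra. }
exists (fun s => Derive phi (n s) *
   (((r + s * w1) * z1 + s * w2 * z2) / n s)).
split; [|split].
- rewrite n0; field; lra.
(* For small [s] the bond keeps a positive first component, so its length is positive and both [phi]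
   and the square root are differentiable there. *)
- assert (L : locally 0 (fun s => 0 < r + s * w1)).
  { assert (C : continuous (fun s => r + s * w1) 0).
    { apply (ex_derive_continuous (V := R_NormedModule)); auto_derive; exact I. }
    apply C; apply (open_gt 0); lra. }
  revert L; apply filter_imp; intros s hs.
  assert (P : 0 < (r + s * w1) ^ 2 + (s * w2) ^ 2) by nra.
  assert (Pn : 0 < n s) by (apply sqrt_lt_R0; exact P).
  replace (Derive phi (n s) * _) with
    (scal (((r + s * w1) * z1 + s * w2 * z2) / n s) (Derive phi (n s)))
    by (unfold scal; simpl; unfold mult; simpl; ring).
  apply (is_derive_comp phi (fun t =>
      sqrt ((r + s * w1 + t * z1) ^ 2 + (s * w2 + t * z2) ^ 2))).
  + replace (sqrt _) with (n s)
      by (unfold n; f_equal; ring).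
    apply Derive_correct, (proj1 (hphi _ Pn)).
  + auto_derive.
    * replace (_ + _) with ((r + s * w1) ^ 2 + (s * w2) ^ 2) by ring.
      repeat split; exact P.
    * unfold n in *.
      replace (sqrt (_ * (_ * 1) + _)) with
        (sqrt ((r + s * w1) ^ 2 + (s * w2) ^ 2)) by (f_equal; ring).
      field; lra.
- assert (Dn : is_derive n 0 w1).
  { unfold n; auto_derive.
    - replace (_ + _) with (r ^ 2) by ring; nra.
    - replace (sqrt _) with r; field; lra. }
  assert (Dp : is_derive (fun s => Derive phi (n s)) 0 (w1 * Derive_n phi 2 r)).
  { apply (is_derive_comp (Derive phi) n); [|exact Dn].
    rewrite n0; exact (Derive_correct _ _ (proj1 (proj2 (hphi _ hr)))). }
  assert (Dl : is_derive (fun s => (r + s * w1) * z1 + s * w2 * z2) 0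
                 (w1 * z1 + w2 * z2)).
  { auto_derive; [exact I|ring]. }
  assert (Dq := is_derive_div _ _ _ _ _ Dl Dn ltac:(rewrite n0; lra)).
  assert (D := is_derive_mult _ _ _ _ _ Dp Dq Rmult_comm).
  simpl in D; rewrite n0 in D.
  match type of D with is_derive _ _ ?x => replace (_ + _) with x; [exact D|] end.
  unfold plus, mult; simpl; unfold mult; simpl; field; lra.
Qed.

(** * Variations of both energies at the straight chain *)

Section StraightChain.

Variables (phi : R -> R) (F : R) (N : nat) (c : R).
Hypotheses (hphi : C2_on_pos phi) (hF : 0 < F) (hN : (0 < N)%nat).

Lemma eps_gt0 : 0 < eps N.
Proof. apply Rinv_0_lt_compat, lt_0_INR; exact hN. Qed.

Lemma bdiff_R2 (y : lattice_seq) k :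
  bdiff N y k = (/ eps N * (fst (y k) - fst (y (k - 1)%Z)),
                 / eps N * (snd (y k) - snd (y (k - 1)%Z))).
Proof. reflexivity. Qed.

Lemma fst_bdiff (y : lattice_seq) k :
  fst (bdiff N y k) = / eps N * (fst (y k) - fst (y (k - 1)%Z)).
Proof. reflexivity. Qed.

Lemma snd_bdiff (y : lattice_seq) k :
  snd (bdiff N y k) = / eps N * (snd (y k) - snd (y (k - 1)%Z)).
Proof. reflexivity. Qed.

(** The translation [c] cancels, and the chain contributes the constant difference [(F, 0)]. *)
Lemma bdiff_chain (u v : lattice_seq) s t k :
  bdiff N (seq_plus (seq_plus (straight_chain N F c) (seq_scal s u))
                    (seq_scal t v)) k =
  (F + s * fst (bdiff N u k) + t * fst (bdiff N v k),
   s * snd (bdiff N u k) + t * snd (bdiff N v k)).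
Proof.
assert (H := eps_gt0).
rewrite !bdiff_R2; unfold seq_plus, seq_scal, straight_chain, plus, scal; simpl.
unfold plus, scal; simpl; unfold mult; simpl.
rewrite minus_IZR; f_equal; field; lra.
Qed.

Lemma norm_pair (a b : R) : norm ((a, b) : R2) = sqrt (a ^ 2 + b ^ 2).
Proof. rewrite norm_R2; f_equal; unfold dot; simpl; ring. Qed.

Lemma norm_plus_pair (a b a' b' : R) :
  norm (plus ((a, b) : R2) (a', b')) = sqrt ((a + a') ^ 2 + (b + b') ^ 2).
Proof. exact (norm_pair (a + a') (b + b')). Qed.

Definition first_a (v : lattice_seq) : R :=
  eps N * period_sum N (fun k =>
    Derive phi F * fst (bdiff N v k) +
    Derive phi (2 * F) * (fst (bdiff N v (k + 1)%Z) + fst (bdiff N v k))).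

Definition hessian_a (u v : lattice_seq) : R :=
  eps N * period_sum N (fun k =>
    (Derive_n phi 2 F * (fst (bdiff N u k) * fst (bdiff N v k)) +
     Derive phi F / F * (snd (bdiff N u k) * snd (bdiff N v k))) +
    (Derive_n phi 2 (2 * F) *
       ((fst (bdiff N u (k + 1)%Z) + fst (bdiff N u k)) *
        (fst (bdiff N v (k + 1)%Z) + fst (bdiff N v k))) +
     Derive phi (2 * F) / (2 * F) *
       ((snd (bdiff N u (k + 1)%Z) + snd (bdiff N u k)) *
        (snd (bdiff N v (k + 1)%Z) + snd (bdiff N v k))))).

Definition first_CB (v : lattice_seq) : R :=
  eps N * period_sum N (fun k =>
    Derive phi F * fst (bdiff N v k) +
    Derive phi (2 * F) * (2 * fst (bdiff N v k))).

Definition hessian_CB (u v : lattice_seq) : R :=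
  eps N * period_sum N (fun k =>
    (Derive_n phi 2 F * (fst (bdiff N u k) * fst (bdiff N v k)) +
     Derive phi F / F * (snd (bdiff N u k) * snd (bdiff N v k))) +
    (Derive_n phi 2 (2 * F) *
       ((2 * fst (bdiff N u k)) * (2 * fst (bdiff N v k))) +
     Derive phi (2 * F) / (2 * F) *
       ((2 * snd (bdiff N u k)) * (2 * snd (bdiff N v k))))).

Lemma energy_a_variations (u v : lattice_seq) :
  has_variations (fun s t => energy_a phi N
    (seq_plus (seq_plus (straight_chain N F c) (seq_scal s u)) (seq_scal t v)))
    (first_a v) (hessian_a u v).
Proof.
unfold energy_a; apply has_variations_scal.
apply (has_variations_period_sum N (fun k s t => _ + _)); intros k.
apply has_variations_plus.
- apply has_variations_ext with
    (2 := has_variations_bond phi F _ _ _ _ hphi hF).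
  intros s t; rewrite bdiff_chain, norm_pair; reflexivity.
- apply has_variations_ext with
    (2 := has_variations_bond phi (2 * F) _ _ _ _ hphi ltac:(lra)).
  intros s t; rewrite !bdiff_chain, norm_plus_pair; do 2 f_equal; ring.
Qed.

Lemma energy_CB_variations (u v : lattice_seq) :
  has_variations (fun s t => energy_CB phi N
    (seq_plus (seq_plus (straight_chain N F c) (seq_scal s u)) (seq_scal t v)))
    (first_CB v) (hessian_CB u v).
Proof.
unfold energy_CB; apply has_variations_scal.
apply (has_variations_period_sum N (fun k s t => _ + _)); intros k.
apply has_variations_plus.
- apply has_variations_ext with
    (2 := has_variations_bond phi F _ _ _ _ hphi hF).
  intros s t; rewrite bdiff_chain, norm_pair; reflexivity.
- apply has_variations_ext with
    (2 := has_variations_bond phi (2 * F) _ _ _ _ hphi ltac:(lra)).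
  intros s t; rewrite bdiff_chain, norm_pair; f_equal.
  (* The factor 2 moves inside the norm, so that the second Cauchy-Born term is a bond of length
     [2 * F] perturbed by twice the differences of [u] and [v]. *)
  transitivity (sqrt (2 ^ 2) *
    sqrt ((F + s * fst (bdiff N u k) + t * fst (bdiff N v k)) ^ 2 +
          (s * snd (bdiff N u k) + t * snd (bdiff N v k)) ^ 2)).
  + rewrite <- sqrt_mult
      by (try apply Rplus_le_le_0_compat; apply pow2_ge_0).
    f_equal; ring.
  + rewrite sqrt_pow2 by lra; reflexivity.
Qed.

(** At [s = 0] the two-parameter family agrees with [y + t v] only pointwise. The second hypothesis,
    that [E] sees a sequence only through the values of its differences, bridges this gap without
    functional extensionality. *)
Lemma variation1_of_variations (E : lattice_seq -> R) (y v : lattice_seq) a b :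
  has_variations (fun s t =>
    E (seq_plus (seq_plus y (seq_scal s v)) (seq_scal t v))) a b ->
  (forall y z, (forall k, bdiff N y k = bdiff N z k) -> E y = E z) ->
  variation1 E y v = a.
Proof.
intros H HE; rewrite <- (has_variations_Derive _ _ _ H).
apply Derive_ext; intros t; apply HE; intros k; rewrite !bdiff_R2.
unfold seq_plus, seq_scal, plus, scal; simpl.
unfold plus, scal; simpl; unfold mult; simpl.
f_equal; ring.
Qed.

Lemma linearized_a (f u v : lattice_seq) :
  linearized_solution (energy_a phi N) N (straight_chain N F c) f u ->
  displacement N v -> first_a v + hessian_a u v = inner N f v.
Proof.
intros H hv; rewrite <- (H v hv); symmetry; f_equal.
- apply variation1_of_variations with (1 := energy_a_variations v v).
  intros y z E; unfold energy_a; f_equal; apply period_sum_ext; intros k.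
  rewrite !E; reflexivity.
- exact (has_variations_Derive2 _ _ _ (energy_a_variations u v)).
Qed.

Lemma linearized_CB (f u v : lattice_seq) :
  linearized_solution (energy_CB phi N) N (straight_chain N F c) f u ->
  displacement N v -> first_CB v + hessian_CB u v = inner N f v.
Proof.
intros H hv; rewrite <- (H v hv); symmetry; f_equal.
- apply variation1_of_variations with (1 := energy_CB_variations v v).
  intros y z E; unfold energy_CB; f_equal; apply period_sum_ext; intros k.
  rewrite !E; reflexivity.
- exact (has_variations_Derive2 _ _ _ (energy_CB_variations u v)).
Qed.

End StraightChain.

(** * Differences of displacements, periodicity and the third difference *)

Lemma displacement_minus N u v :
  displacement N u -> displacement N v -> displacement N (seq_minus u v).
Proof.
intros [pu su] [pv sv]; split.
- intros l; unfold seq_minus; rewrite pu, pv; reflexivity.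
- unfold seq_minus.
  (* Adding [v] back to [u - v] recovers [u], so the sum of [u - v] vanishes by additivity alone. *)
  assert (H := period_sum_plus (G := NormedModule.AbelianMonoid _ R2) N
                 (fun l => minus (u l) (v l)) v).
  rewrite sv, plus_zero_r in H; rewrite <- H, <- su.
  apply sum_n_m_ext; intros k.
  exact (eq_trans (eq_sym (plus_assoc _ _ _))
           (eq_trans (f_equal (plus _) (plus_opp_l _)) (plus_zero_r _))).
Qed.

Lemma bdiff_minus N u v k :
  bdiff N (seq_minus u v) k = minus (bdiff N u k) (bdiff N v k).
Proof.
rewrite !bdiff_R2.
apply injective_projections; unfold seq_minus, minus, plus, opp; simpl;
  unfold plus, opp; simpl; ring.
Qed.

Lemma bdiff_periodic N u :
  (forall l, u (l + Z.of_nat N)%Z = u l) ->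
  forall l, bdiff N u (l + Z.of_nat N)%Z = bdiff N u l.
Proof.
intros H l; unfold bdiff.
replace (l + Z.of_nat N - 1)%Z with (l - 1 + Z.of_nat N)%Z by lia.
rewrite !H; reflexivity.
Qed.

Lemma bdiff_n_periodic n N u :
  (forall l, u (l + Z.of_nat N)%Z = u l) ->
  forall l, bdiff_n n N u (l + Z.of_nat N)%Z = bdiff_n n N u l.
Proof.
intros H; induction n as [|n IH]; [exact H|].
exact (bdiff_periodic N _ IH).
Qed.

(** Two further backward differences of [u'], taken at [k + 1], reach back to [k - 1]; hence the
    centred second difference at [k] is paired with the index [k + 1]. *)
Lemma bdiff_n_3 N (u : lattice_seq) k : (0 < N)%nat ->
  fst (bdiff N u (k + 1)%Z) - 2 * fst (bdiff N u k) + fst (bdiff N u (k - 1)%Z)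
    = eps N ^ 2 * fst (bdiff_n 3 N u (k + 1)%Z) /\
  snd (bdiff N u (k + 1)%Z) - 2 * snd (bdiff N u k) + snd (bdiff N u (k - 1)%Z)
    = eps N ^ 2 * snd (bdiff_n 3 N u (k + 1)%Z).
Proof.
intros hN; assert (H := eps_gt0 N hN).
change (bdiff_n 3 N u) with (bdiff N (bdiff N (bdiff N u))).
set (q := bdiff N u).
rewrite !fst_bdiff, !snd_bdiff.
replace (k + 1 - 1)%Z with k by lia.
split; field; lra.
Qed.

(** * Young's inequality and comparison of norms *)

(** The right side minus the left is a sum of two nonnegative terms, one from [a ^ 2 <= K ^ 2] and
    one a square. The weight [g / 2] on [d ^ 2] consumes exactly half of the coercivity constant. *)
Lemma young_weighted g K a w d :
  0 < g -> Rabs a <= K -> a * w * d <= K ^ 2 / (2 * g) * w ^ 2 + g / 2 * d ^ 2.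
Proof.
intros hg ha.
assert (a ^ 2 <= K ^ 2).
{ rewrite <- (pow2_abs a); assert (H := Rabs_pos a); nra. }
assert (E : K ^ 2 / (2 * g) * w ^ 2 + g / 2 * d ^ 2 - a * w * d =
  (K ^ 2 - a ^ 2) * w ^ 2 / (2 * g) + (a * w - g * d) ^ 2 / (2 * g))
  by (field; lra).
assert (0 <= (K ^ 2 - a ^ 2) * w ^ 2 / (2 * g)).
{ apply Rdiv_le_0_compat; [|lra]; apply Rmult_le_pos; [lra|apply pow2_ge_0]. }
assert (0 <= (a * w - g * d) ^ 2 / (2 * g)).
{ apply Rdiv_le_0_compat; [apply pow2_ge_0|lra]. }
lra.
Qed.

Lemma inner_ge0 N v : (0 < N)%nat -> 0 <= inner N v v.
Proof.
intros hN; apply Rmult_le_pos; [left; apply eps_gt0; exact hN|].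
apply Rle_trans with (period_sum N (fun _ : Z => 0)).
- right; symmetry; apply (sum_n_m_const_zero (G := R_AbelianMonoid)).
- apply period_sum_le; intros k; unfold dot; nra.
Qed.

Lemma l2norm_le N v w C : (0 < N)%nat -> 0 <= C ->
  inner N v v <= C ^ 2 * inner N w w -> l2norm N v <= C * l2norm N w.
Proof.
intros hN hC H; unfold l2norm.
rewrite <- (sqrt_pow2 C) by exact hC.
rewrite <- sqrt_mult by (try apply pow2_ge_0; apply inner_ge0; exact hN).
apply sqrt_le_1_alt; exact H.
Qed.

(** * The error estimate *)

Theorem theorem8p2 (phi : R -> R) (hphi : C2_on_pos phi)
  (F : R) (hF : 0 < F) (N : nat) (hN : (2 <= N)%nat) (c : R)
  (f ua uCB : lattice_seq)
  (hf : displacement N f) (hua : displacement N ua) (huCB : displacement N uCB)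
  (eq_a : linearized_solution (energy_a phi N) N (straight_chain N F c) f ua)
  (eq_CB :
     linearized_solution (energy_CB phi N) N (straight_chain N F c) f uCB)
  (hgamma : 0 < gamma2 phi F) :
  l2norm N (bdiff N (seq_minus ua uCB)) <=
    eps N ^ 2 * Rmax (Rabs (Derive_n phi 2 (2 * F)))
                     (Rabs (Derive phi (2 * F) / (2 * F)))
      / gamma2 phi F
    * l2norm N (bdiff_n 3 N ua).
Proof.
assert (hN0 : (0 < N)%nat) by lia.
assert (he := eps_gt0 N hN0).
assert (hd := displacement_minus N ua uCB hua huCB).
assert (Ea := linearized_a phi F N c hphi hF hN0 f ua _ eq_a hd).
assert (EC := linearized_CB phi F N c hphi hF hN0 f uCB _ eq_CB hd).
(* Both equations have the same right-hand side for this test function, so [f] is eliminated. *)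
rewrite <- EC in Ea; clear EC.
assert (Bd := bdiff_minus N ua uCB).
assert (Pd := bdiff_periodic N _ (proj1 hd)).
assert (Pq := bdiff_periodic N _ (proj1 hua)).
assert (Pw := bdiff_n_periodic 3 N _ (proj1 hua)).
assert (Hw := fun k => bdiff_n_3 N ua k hN0).
unfold first_a, first_CB, hessian_a, hessian_CB in Ea.
set (d := bdiff N (seq_minus ua uCB)) in *.
set (q := bdiff N ua) in *.
set (w := bdiff_n 3 N ua) in *.
set (p := bdiff N uCB) in *.
set (M := Rmax _ _).
set (al := Derive_n phi 2 (2 * F)) in *.
set (be := Derive phi (2 * F) / (2 * F)) in *.
set (g := gamma2 phi F) in *.
set (K := eps N ^ 2 * M).
assert (h2 := pow2_ge_0 (eps N)).
assert (hal : Rabs (- (eps N ^ 2 * al)) <= K).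
{ rewrite Rabs_Ropp, Rabs_mult, (Rabs_pos_eq (eps N ^ 2)) by exact h2.
  apply Rmult_le_compat_l; [exact h2|apply Rmax_l]. }
assert (hbe : Rabs (- (eps N ^ 2 * be)) <= K).
{ rewrite Rabs_Ropp, Rabs_mult, (Rabs_pos_eq (eps N ^ 2)) by exact h2.
  apply Rmult_le_compat_l; [exact h2|apply Rmax_r]. }
assert (hK : 0 <= K) by (eapply Rle_trans; [apply Rabs_pos|exact hal]).
assert (g1 : g <= Derive_n phi 2 F + 4 * al) by apply Rmin_l.
(* The coefficient 2 in [gamma2] becomes 4 because [be] is divided by [2 * F]. *)
assert (g2 : g <= Derive phi F / F + 4 * be).
{ eapply Rle_trans; [apply Rmin_r|]; right; unfold be; field; lra. }
(* All terms that cancel over a period are gathered here: the first shifts the weight on [w] from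
   [k] to [k + 1], the second absorbs the difference of the two first variations, and the last two
   come from the Hessians. *)
set (T := fun k : Z => K ^ 2 / (2 * g) * dot (w k) (w k)
  - Derive phi (2 * F) * fst (d k)
  - al * ((fst (q k) + fst (q (k - 1)%Z)) * fst (d k))
  - be * ((snd (q k) + snd (q (k - 1)%Z)) * snd (d k))).
assert (PT : forall k, T (k + Z.of_nat N)%Z = T k).
{ intros k; unfold T; rewrite Pw, Pd, Pq.
  replace (k + Z.of_nat N - 1)%Z with (k - 1 + Z.of_nat N)%Z by lia.
  rewrite Pq; reflexivity. }
assert (ST := period_sum_telescope N T PT).
rewrite <- !Rmult_plus_distr_l in Ea.
apply Rmult_eq_reg_l in Ea; [|lra].
rewrite <- !(period_sum_Rplus N) in Ea.
match type of Ea with period_sum N ?x = period_sum N ?y =>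
  set (X := x) in Ea; set (Y := y) in Ea end.
(* The inequality holds term by term. Writing [p = q - d] in [Y] produces the coercive term, which
   by [g1] and [g2] is at least [g] times [dot (d k) (d k)]; Young's inequality spends half of it on
   the second differences of [q]. *)
assert (S : period_sum N (fun k => g / 2 * dot (d k) (d k) + Y k) <=
            period_sum N (fun k => K ^ 2 / (2 * g) * dot (w k) (w k) + X k
                                   + (T (k + 1)%Z - T k))).
{ apply period_sum_le; intros k.
  destruct (Hw k) as [w1 w2].
  assert (sub_sub : forall a b : R, a = b - (b - a)) by (intros; ring).
  assert (d1 : fst (p k) = fst (q k) - fst (d k)).
  { rewrite Bd; exact (sub_sub _ _). }
  assert (d2 : snd (p k) = snd (q k) - snd (d k)).
  { rewrite Bd; exact (sub_sub _ _). }
  assert (Y1 := young_weighted g K _ (fst (w (k + 1)%Z)) (fst (d k)) hgamma hal).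
  assert (Y2 := young_weighted g K _ (snd (w (k + 1)%Z)) (snd (d k)) hgamma hbe).
  assert (G1 := Rmult_le_compat_r _ _ _ (pow2_ge_0 (fst (d k))) g1).
  assert (G2 := Rmult_le_compat_r _ _ _ (pow2_ge_0 (snd (d k))) g2).
  replace (- (eps N ^ 2 * al) * fst (w (k + 1)%Z)) with
    (- al * (eps N ^ 2 * fst (w (k + 1)%Z))) in Y1 by ring.
  replace (- (eps N ^ 2 * be) * snd (w (k + 1)%Z)) with
    (- be * (eps N ^ 2 * snd (w (k + 1)%Z))) in Y2 by ring.
  rewrite <- w1 in Y1; rewrite <- w2 in Y2.
  unfold X, Y, T, dot.
  replace (k + 1 - 1)%Z with k by lia.
  rewrite d1, d2.
  lra. }
(* The increments of [T] sum to zero and the sums of [X] and [Y] agree, so only the sums of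
   [dot (d k) (d k)] and [dot (w k) (w k)] matter. Multiplying by [2 / g] then gives the squared
   constant [(K / g) ^ 2]. *)
rewrite !(period_sum_Rplus N), ST, Ea in S.
rewrite !(period_sum_Rmult N) in S.
apply l2norm_le; [exact hN0|apply Rdiv_le_0_compat; assumption|].
unfold inner.
set (D := period_sum N (fun l => dot (d l) (d l))) in *.
set (W := period_sum N (fun l => dot (w l) (w l))) in *.
replace ((K / g) ^ 2 * (eps N * W)) with
  (eps N * (2 / g * (K ^ 2 / (2 * g) * W))) by (field; lra).
apply Rmult_le_compat_l; [lra|].
replace D with (2 / g * (g / 2 * D)) by (field; lra).
apply Rmult_le_compat_l; [|lra].
apply Rdiv_le_0_compat; lra.
Qed.
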